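(* Let $M^n=\mathbb{S}^{p+1}_{+}\times\mathbb{S}^q$, $q>1$, with the doubly warped product metric $$g=dr^2+\sin^2(r)\,g_{\mathbb{S}^p}+\frac{q-1}{p+1}\,g_{\mathbb{S}^q},$$ where $r(x,y)=r(x)$ is the height function of $\mathbb{S}^{p+1}_{+}$. Considering the potential function $f(r)=\cos(r)$ with $r\leq\frac{\pi}{2}$, $(M^n,g)$ satisfies the static perfect fluid space-time equations $$f\,\mathring{Ric}=\mathring{\nabla}^2 f\qquad\text{and}\qquad \Delta f=\left(\frac{n-2}{2(n-1)}R+\frac{n}{n-1}\rho\right)f$$ (for some smooth function $\rho$ on $M^n$).
   Context: Here $n=p+q+1$, $\mathbb{S}^{p+1}_+$ is the closed unit hemisphere with its standard metric $dr^2+\sin^2(r)\,g_{\mathbb{S}^p}$, $0\le r\le\frac{\pi}{2}$, and $g_{\mathbb{S}^k}$ is the standard metric on the unit sphere $\mathbb{S}^k$. $R$ and $Ric$ are the scalar and Ricci curvatures of $g$, $\mathring{Ric}=Ric-\frac{R}{n}g$ is the traceless Ricci tensor, $\mathring{\nabla}^2 f=\nabla^2 f-\frac{\Delta f}{n}g$ is the traceless Hessian of $f$, and $\Delta f=\mathrm{tr}_g\nabla^2 f$. A static perfect fluid space-time is a Riemannian manifold with smooth functions $f$ and $\rho$ satisfying these two equations, with $f>0$ in the interior and $f^{-1}(0)=\partial M$ when the boundary is non-empty. *)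

(* Defs.v *)
From HB Require Import structures.
From mathcomp Require Import all_boot all_order all_algebra.
From mathcomp Require Import all_classical all_reals all_analysis.

Unset Printing Implicit Defensive.

Import Order.TTheory GRing.Theory Num.Theory.
Import numFieldNormedType.Exports.

Local Open Scope classical_set_scope.
Local Open Scope ring_scope.

Definition pder {R : realType} {n : nat} {W : normedModType R}
  (i : 'I_n) (h : 'rV[R]_n -> W) : 'rV[R]_n -> W :=
  fun x => 'D_(delta_mx ord0 i) h x.

(* On an open set, being infinitely differentiable amounts to: every iterated
   partial derivative is (Frechet) differentiable at every point. *)
Definition smooth_on {R : realType} {n : nat} {W : normedModType R}
  (U : set 'rV[R]_n) (h : 'rV[R]_n -> W) : Prop :=
  forall (s : seq 'I_n) (x : 'rV[R]_n), U x ->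
    differentiable (foldr (fun i k => pder i k) h s) x.

(* Smooth functions on an arbitrary subset A of a Euclidean space: those which
   locally extend to smooth functions on open sets.  When A is an embedded
   manifold, possibly with boundary, these are its smooth functions. *)
Definition smooth_on_subset {R : realType} {N : nat}
  (A : set 'rV[R]_N) (h : 'rV[R]_N -> R) : Prop :=
  forall z, A z -> exists (V : set 'rV[R]_N) (k : 'rV[R]_N -> R),
    [/\ open V, V z, smooth_on V k & forall w, V w -> A w -> k w = h w].

(** Riemannian geometry in coordinates: g x i j are the components of the
    metric in a coordinate system of dimension n. *)
Section Coordinates.
Context {R : realType} {n : nat}.
Implicit Types (g : 'rV[R]_n -> 'M[R]_n) (F : 'rV[R]_n -> R).
Implicit Types (x : 'rV[R]_n) (i j k l m : 'I_n).

Definition ginv g x : 'M[R]_n := invmx (g x).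

(* Gamma^k_{ij} *)
Definition christoffel g k i j x : R :=
  2^-1 * \sum_l ginv g x k l *
    (pder i (fun y => g y j l) x + pder j (fun y => g y i l) x
     - pder l (fun y => g y i j) x).

(* The component R^l_{ijk} in the convention
   R(d_i, d_j) d_k = nabla_i nabla_j d_k - nabla_j nabla_i d_k
                   = sum_l R^l_{ijk} d_l. *)
Definition riemann g l i j k x : R :=
  pder i (christoffel g l j k) x - pder j (christoffel g l i k) x
  + \sum_m (christoffel g l i m x * christoffel g m j k x
            - christoffel g l j m x * christoffel g m i k x).

(* Ric(Y, Z) is the trace of X |-> R(X, Y) Z: positive on round spheres. *)
Definition ricci g x : 'M[R]_n := \matrix_(j, k) \sum_i riemann g i i j k x.

Definition gtrace g (T : 'M[R]_n) x : R :=
  \sum_i \sum_j ginv g x i j * T i j.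

Definition scalar_curvature g x : R := gtrace g (ricci g x) x.

Definition hessian g F x : 'M[R]_n :=
  \matrix_(i, j) (pder i (pder j F) x
                  - \sum_k christoffel g k i j x * pder k F x).

Definition laplacian g F x : R := gtrace g (hessian g F x) x.

Definition traceless_ricci g x : 'M[R]_n :=
  ricci g x - (scalar_curvature g x / n%:R) *: g x.

Definition traceless_hessian g F x : 'M[R]_n :=
  hessian g F x - (laplacian g F x / n%:R) *: g x.

End Coordinates.

(* Local parametrizations (inverse charts) of an n-dimensional submanifold X,
   without boundary, of a Euclidean space: smooth immersions of open subsets U
   of R^n which are homeomorphisms onto relatively open subsets of X. *)
Definition local_parametrization {R : realType} {n N : nat}
  (X : set 'rV[R]_N) (U : set 'rV[R]_n) (phi : 'rV[R]_n -> 'rV[R]_N) : Prop :=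
  [/\ open U, smooth_on U phi, (forall u, U u -> row_free ('J phi u)),
      {in U &, injective phi} &
      forall O : set 'rV[R]_n, open O -> O `<=` U ->
        exists V : set 'rV[R]_N, open V /\ phi @` O = X `&` V].

(* G z v w is the value at the point z of the metric on tangent vectors v, w. *)
Definition metric_components {R : realType} {n N : nat}
  (G : 'rV[R]_N -> 'rV[R]_N -> 'rV[R]_N -> R) (phi : 'rV[R]_n -> 'rV[R]_N)
  (u : 'rV[R]_n) : 'M[R]_n :=
  \matrix_(i, j) G (phi u) (pder i phi u) (pder j phi u).

Definition interior_in {R : realType} {N : nat} (X M : set 'rV[R]_N) :
  set 'rV[R]_N :=
  [set z | M z /\ exists V, [/\ open V, V z & X `&` V `<=` M]].

Definition boundary_in {R : realType} {N : nat} (X M : set 'rV[R]_N) :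
  set 'rV[R]_N := M `\` interior_in X M.

(* The two equations at every point of M, boundary included, in every local
   coordinate system.  A manifold with boundary M is presented as a domain in a
   manifold X without boundary and of the same dimension n, on which the metric
   G and f are defined; the derivatives at boundary points of M are thus those
   of the extensions to X. *)
Definition perfect_fluid_equations {R : realType} (n : nat) {N : nat}
  (X M : set 'rV[R]_N) (G : 'rV[R]_N -> 'rV[R]_N -> 'rV[R]_N -> R)
  (f rho : 'rV[R]_N -> R) : Prop :=
  forall (U : set 'rV[R]_n) (phi : 'rV[R]_n -> 'rV[R]_N),
    local_parametrization X U phi ->
  forall u : 'rV[R]_n, U u -> M (phi u) ->
    let g := metric_components G phi in
    let F := f \o phi in
    F u *: traceless_ricci g u = traceless_hessian g F u /\
    laplacian g F u =
      ((n%:R - 2) / (2 * (n%:R - 1)) * scalar_curvature g u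
       + n%:R / (n%:R - 1) * rho (phi u)) * F u.

Definition static_perfect_fluid {R : realType} (n : nat) {N : nat}
  (X M : set 'rV[R]_N) (G : 'rV[R]_N -> 'rV[R]_N -> 'rV[R]_N -> R)
  (f rho : 'rV[R]_N -> R) : Prop :=
  [/\ smooth_on_subset X f, smooth_on_subset M rho,
      (forall z, interior_in X M z -> 0 < f z),
      (forall z, M z -> (f z = 0 <-> boundary_in X M z)) &
      perfect_fluid_equations n X M G f rho].

Definition dotv {R : realType} {k : nat} (v w : 'rV[R]_k) : R :=
  \sum_i v ord0 i * w ord0 i.

(* The unit sphere S^k in R^(k+1). *)
Definition sphere {R : realType} (k : nat) : set 'rV[R]_k.+1 :=
  [set x | dotv x x = 1].

(* The standard metric g_{S^k} at x, on vectors tangent to the sphere. *)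
Definition sphere_metric {R : realType} {k : nat} (x v w : 'rV[R]_k.+1) : R :=
  dotv v w.

(* Polar coordinates x = (cos r, sin r * omega) on S^(p+1), with omega in S^p:
   r is the distance to the pole (1, 0, ..., 0). *)
Definition height {R : realType} {p : nat} (x : 'rV[R]_p.+2) : R :=
  acos (x ord0 ord0).

Definition angular {R : realType} {p : nat} (x : 'rV[R]_p.+2) : 'rV[R]_p.+1 :=
  (sin (height x))^-1 *: \row_(j < p.+1) x ord0 (lift ord0 j).

(* dr^2 + sin^2(r) g_{S^p}.  Polar coordinates degenerate at the two poles,
   where the value of the metric is its continuous extension. *)
Definition warped_metric {R : realType} {p : nat} (x v w : 'rV[R]_p.+2) : R :=
  if sin (height x) == 0 then dotv v w
  else 'D_v height x * 'D_w height x
       + sin (height x) ^+ 2 *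
         sphere_metric (angular x) ('D_v angular x) ('D_w angular x).

(* S^(p+1) x S^q in R^(p+2) x R^(q+1). *)
Definition sphere_product {R : realType} (p q : nat) :
  set 'rV[R]_(p.+2 + q.+1) :=
  [set z | sphere p.+1 (lsubmx z) /\ sphere q (rsubmx z)].

Definition hemisphere_product {R : realType} (p q : nat) :
  set 'rV[R]_(p.+2 + q.+1) :=
  [set z | sphere_product p q z /\ height (lsubmx z) <= pi / 2].

Definition doubly_warped_metric {R : realType} (p q : nat)
  (z v w : 'rV[R]_(p.+2 + q.+1)) : R :=
  warped_metric (lsubmx z) (lsubmx v) (lsubmx w)
  + (q%:R - 1) / (p%:R + 1) *
    sphere_metric (rsubmx z) (rsubmx v) (rsubmx w).

Definition potential {R : realType} (p q : nat) (z : 'rV[R]_(p.+2 + q.+1)) : R :=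
  cos (height (lsubmx z)).

(* Main.v *)
(**
On vectors tangent to S^(p+1) x S^q, the warped metric is v1.w1 + c v2.w2 with
c = (q-1)/(p+1), and the potential is the first ambient coordinate.  In a
chart (P, Q), put a_ij = d_i P . d_j P and b_ij = d_i Q . d_j Q, so that
g = a + c b.  Since the tangent vectors and the two normals (P, 0), (0, Q) span
the ambient space, d_i d_j P = Gamma^k_ij d_k P - a_ij P, and likewise for Q.
Reading the first coordinate of P gives Hess f = - f a; differentiating once
more and using that third derivatives commute gives the Gauss equation, whose
trace is Ric = p a + (q-1) b.  As q-1 = c (p+1), both equations are then
identities in f, a, b, with the constant rho = - (p+1)(n-1)/2.
*)

Require Import Defs.
From mathcomp Require Import all_boot all_order all_algebra.
From mathcomp Require Import all_classical all_reals all_analysis.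
From mathcomp Require Import ring lra zify.

Set Implicit Arguments.
Unset Strict Implicit.
Unset Printing Implicit Defensive.

Import Order.TTheory GRing.Theory Num.Theory.
Import numFieldNormedType.Exports.

Local Open Scope classical_set_scope.
Local Open Scope ring_scope.

(** * Gram matrices *)

(** The intended sizes [n + (1 + 1)] and [m1 + m2] are equal only through a proof, which has to be
    eliminated before [mulmx1C] can be applied. *)
Lemma mulmx1C_eq (F : fieldType) m n (A : 'M[F]_(m, n)) (B : 'M[F]_(n, m)) :
  m = n -> A *m B = 1%:M -> B *m A = 1%:M.
Proof. by move=> e; case: n / e A B => A B; exact: mulmx1C. Qed.

Lemma row_mulmx_tr_eq0 (F : realFieldType) n (v : 'rV[F]_n) :
  (v *m v^T) ord0 ord0 = 0 -> v = 0.
Proof.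
rewrite mxE => /eqP; rewrite psumr_eq0; last first.
  by move=> i _; rewrite mxE -expr2 sqr_ge0.
move=> /allP v0; apply/rowP => i; rewrite mxE.
have := v0 i (mem_index_enum _); rewrite mxE -expr2 sqrf_eq0.
by move=> /eqP.
Qed.

Lemma row_mulmx_tr_ge0 (F : realFieldType) n (v : 'rV[F]_n) :
  0 <= (v *m v^T) ord0 ord0.
Proof. by rewrite mxE; apply: sumr_ge0 => i _; rewrite mxE -expr2 sqr_ge0. Qed.

Section GramMatrix.
Variables (F : realFieldType) (n m1 m2 : nat).
Variables (J1 : 'M[F]_(n, m1)) (J2 : 'M[F]_(n, m2)).
Variables (y1 : 'rV[F]_m1) (y2 : 'rV[F]_m2) (c : F).
Hypothesis c_gt0 : 0 < c.
Hypothesis dimE : (n + (1 + 1) = m1 + m2)%N.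
Hypothesis J_free : row_free (row_mx J1 J2).
Hypotheses (yJ1 : y1 *m J1^T = 0) (yJ2 : y2 *m J2^T = 0).
Hypotheses (yy1 : y1 *m y1^T = 1%:M) (yy2 : y2 *m y2^T = 1%:M).

Let g := J1 *m J1^T + c *: (J2 *m J2^T).

(** Pairing [v *m g] with [v] gives [|v J1|^2 + c |v J2|^2], so a kernel vector is killed by both
    blocks, hence by the injective [row_mx J1 J2]. *)
Lemma gram_unit : g \in unitmx.
Proof.
rewrite -row_free_unit; apply/inj_row_free => v vg0.
apply: (row_free_inj J_free); rewrite mul0mx mul_mx_row.
have : (v *m g *m v^T) ord0 ord0 = 0 by rewrite vg0 mul0mx mxE.
rewrite /g mulmxDr mulmxDl -scalemxAr -scalemxAl !mulmxA.
rewrite -(mulmxA (v *m J1)) -trmx_mul -(mulmxA (v *m J2)) -trmx_mul.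
rewrite mxE [X in _ + X]mxE => /eqP.
rewrite paddr_eq0 ?mulr_ge0 ?row_mulmx_tr_ge0 ?(ltW c_gt0)//.
rewrite mulf_eq0 (gt_eqF c_gt0) /= => /andP[/eqP v1 /eqP v2].
by rewrite (row_mulmx_tr_eq0 v1) (row_mulmx_tr_eq0 v2) row_mx0.
Qed.

(* With the normals (y1, 0) and (0, y2), the tangent vectors form a basis of
   the ambient space; the blocks below express that a right inverse of the
   matrix of this basis, read off its Gram matrix, is also a left inverse. *)
Lemma gram_completeness :
  [/\ J1^T *m invmx g *m J1 = 1%:M - y1^T *m y1,
      J1^T *m invmx g *m J2 = 0,
      J2^T *m invmx g *m J1 = 0 &
      c *: (J2^T *m invmx g *m J2) = 1%:M - y2^T *m y2].
Proof.
pose A := col_mx (row_mx J1 J2) (block_mx y1 0 0 y2).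
(* The factor [c] is the weight of the second block in the ambient inner product of which [g] is the
   Gram matrix. *)
pose B := row_mx (col_mx (J1^T *m invmx g) (c *: (J2^T *m invmx g)))
                 (block_mx y1^T 0 0 y2^T).
have yJ1' : J1 *m y1^T = 0 by rewrite -[LHS]trmxK trmx_mul trmxK yJ1 trmx0.
have yJ2' : J2 *m y2^T = 0 by rewrite -[LHS]trmxK trmx_mul trmxK yJ2 trmx0.
have AB : A *m B = 1%:M.
  rewrite /A /B mul_col_mx !mul_mx_row !mulmx_block mul_row_col mul_row_block.
  rewrite mul_block_col -!scalemxAr !mulmxA !mulmx0 !mul0mx !addr0 !add0r.
  rewrite yJ1 yJ2 yJ1' yJ2' !mul0mx scaler0 yy1 yy2 scalemxAl -mulmxDl.
  rewrite mulmxV ?gram_unit// addr0 row_mx0 col_mx0 -scalar_mx_block.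
  by rewrite -block_mxEv -scalar_mx_block.
have := mulmx1C_eq dimE AB.
rewrite /A /B mul_row_col mul_col_row mulmx_block.
rewrite -!scalemxAl !mulmx0 !mul0mx !addr0 !add0r add_block_mx !addr0.
rewrite scalar_mx_block => /eq_block_mx[E1 E2 E3 E4]; split => //.
- by rewrite -E1 addrK.
- by apply: (scalerI (lt0r_neq0 c_gt0)); rewrite E3 scaler0.
- by rewrite -E4 addrK.
Qed.

End GramMatrix.

(** * Differential calculus *)

Section Calculus.
Context {R : realType}.

Lemma is_derive_sumE (V W : normedModType R) n (h : 'I_n -> V -> W)
    (x v : V) (dh : 'I_n -> W) :
  (forall i, is_derive x v (h i) (dh i)) ->
  is_derive x v (fun y => \sum_(i < n) h i y) (\sum_(i < n) dh i).
Proof.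
move=> hd; rewrite (_ : (fun y => _) = \sum_(i < n) h i).
  exact: is_derive_sum.
by apply/funext => y; rewrite fct_sumE.
Qed.

Lemma derivable_bigsum (V W : normedModType R) (I : Type) (r : seq I)
    (P : pred I) (h : I -> V -> W) (x v : V) :
  (forall i, derivable (h i) x v) ->
  derivable (fun y => \sum_(i <- r | P i) h i y) x v.
Proof.
move=> hd; elim: r => [|i r IH].
  by under eq_fun do rewrite big_nil; exact: derivable_cst.
under eq_fun do rewrite big_cons.
by case: (P i); [exact: (derivableD (hd i) IH) | exact: IH].
Qed.

Lemma derivable_bigprod (V : normedModType R) (I : Type) (r : seq I)
    (P : pred I) (h : I -> V -> R) (x v : V) :
  (forall i, derivable (h i) x v) ->
  derivable (fun y => \prod_(i <- r | P i) h i y) x v.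
Proof.
move=> hd; elim: r => [|i r IH].
  by under eq_fun do rewrite big_nil; exact: derivable_cst.
under eq_fun do rewrite big_cons.
by case: (P i); [exact: (derivableM (hd i) IH) | exact: IH].
Qed.

Lemma derivable_det (V : normedModType R) n (A : V -> 'M[R]_n) (x v : V) :
  (forall i j, derivable (fun y => A y i j) x v) ->
  derivable (fun y => \det (A y)) x v.
Proof.
move=> Ad; apply: derivable_bigsum => s.
apply: derivableM; first exact: derivable_cst.
exact: derivable_bigprod.
Qed.

Lemma derivable_invmx (V : normedModType R) n (A : V -> 'M[R]_n) (x v : V) :
  (forall i j, derivable (fun y => A y i j) x v) ->
  (\forall y \near x, A y \in unitmx) ->
  forall i j, derivable (fun y => invmx (A y) i j) x v.
Proof.
move=> Ad Au i j.
(* Cramer's rule; it holds only near [x], where the matrices are invertible, since [invmx] returns a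
   singular matrix unchanged. *)
apply: (@near_eq_derivable _ _ _
  (fun y => (\det (A y))^-1 * cofactor (A y) j i)).
  by near=> y; rewrite /invmx (near Au y)// !mxE.
have Aux := nbhs_singleton Au.
apply: derivableM.
  apply: derivableV; last exact: derivable_det.
  by rewrite -unitfE -unitmxE.
apply: derivableM; first exact: derivable_cst.
apply: derivable_det => k l.
by under eq_fun do rewrite !mxE; exact: Ad.
Unshelve. all: by end_near. Qed.

(** * Mean value theorem along lines and symmetry of mixed derivatives *)

Lemma is_derive_line (V : normedModType R) (f : V -> R) (x v : V) (s : R) :
  derivable f (x + s *: v) v ->
  is_derive s 1 (fun t : R => f (x + t *: v)) ('D_v f (x + s *: v)).
Proof.
move=> fd.
have E : (fun h : R => h^-1 *: (((fun t : R => f (x + t *: v)) \o shift s)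
            (h *: (1 : R)) - f (x + s *: v))) =
         (fun h : R => h^-1 *: ((f \o shift (x + s *: v)) (h *: v)
            - f (x + s *: v))).
  apply/funext => h /=; congr (_ *: (f _ - _)).
  by rewrite scalerDl [h *: 1]mulr1 addrCA.
by split; [rewrite /derivable E | rewrite /derive E].
Qed.

Lemma MVT_line (V : normedModType R) (f : V -> R) (x v : V) (t : R) :
  0 < t ->
  (forall s, 0 <= s <= t -> derivable f (x + s *: v) v) ->
  exists2 s, 0 <= s <= t &
    f (x + t *: v) - f x = t * 'D_v f (x + s *: v).
Proof.
move=> t0 fd.
have fl s : s \in `[0, t] -> is_derive s 1 (fun t : R => f (x + t *: v))
    ('D_v f (x + s *: v)).
  by rewrite in_itv /= => /fd; exact: is_derive_line.
have fc : {within `[0, t], continuous (fun s : R => f (x + s *: v))}.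
  by apply: derivable_within_continuous => s /fl[].
have fo s : s \in `]0, t[ -> is_derive s 1 (fun t : R => f (x + t *: v))
    ('D_v f (x + s *: v)).
  by move=> st; apply: fl; exact: subset_itv_oo_cc.
have [s] := MVT t0 fo fc.
rewrite in_itv /= => /andP[s0 st]; rewrite scale0r addr0 subr0 => E.
by exists s; rewrite ?ltW // E mulrC.
Qed.

Lemma growth_rate_translate (V W : normedModType R) (f : V -> W) (a x v : V) :
  (fun h : R => h^-1 *: (((fun y => f (y + a)) \o shift x) (h *: v)
     - f (x + a))) =
  (fun h : R => h^-1 *: ((f \o shift (x + a)) (h *: v) - f (x + a))).
Proof. by apply/funext => h /=; rewrite addrA. Qed.

Lemma derive_translate (V W : normedModType R) (f : V -> W) (a x v : V) :
  'D_v (fun y => f (y + a)) x = 'D_v f (x + a).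
Proof. by rewrite /derive growth_rate_translate. Qed.

Lemma derivable_translate (V W : normedModType R) (f : V -> W) (a x v : V) :
  derivable f (x + a) v -> derivable (fun y => f (y + a)) x v.
Proof. by rewrite /derivable growth_rate_translate. Qed.

(** Two mean value theorems: along [v] for the increment [h (y + t *: w) - h y], then along [w] for
    ['D_v h]. *)
Lemma second_difference (V : normedModType R) (h : V -> R) (x v w : V) (t : R) :
  0 < t ->
  (forall s u, 0 <= s <= t -> 0 <= u <= t ->
     derivable h (x + s *: v + u *: w) v /\
     derivable ('D_v h) (x + s *: v + u *: w) w) ->
  exists s u, [/\ 0 <= s <= t, 0 <= u <= t &
    (h (x + t *: v + t *: w) - h (x + t *: v)) - (h (x + t *: w) - h x)
    = t * (t * 'D_w ('D_v h) (x + s *: v + u *: w))].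
Proof.
move=> t0 hd; pose f y := h (y + t *: w) - h y.
have tt : 0 <= t <= t by rewrite lexx ltW.
have t00 : 0 <= (0 : R) <= t by rewrite lexx ltW.
have d1 s : 0 <= s <= t -> derivable h (x + s *: v) v.
  by move=> st; have [] := hd s 0 st t00; rewrite scale0r addr0.
have d2 s : 0 <= s <= t -> derivable (fun y => h (y + t *: w)) (x + s *: v) v.
  by move=> st; have [? _] := hd s t st tt; exact: derivable_translate.
have [s st fE] : exists2 s, 0 <= s <= t &
    f (x + t *: v) - f x = t * 'D_v f (x + s *: v).
  apply: (MVT_line t0) => s st; exact: (derivableB (d2 s st) (d1 s st)).
have [u ut E] := @MVT_line V ('D_v h) (x + s *: v) w t t0
  (fun u ut => (hd s u st ut).2).
exists s, u; split => //.
rewrite -E -/(f _) -/(f x) fE; congr (_ * _).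
by rewrite deriveB ?derive_translate//; [exact: d2|exact: d1].
Qed.

Let second_difference_sym (a b c d : R) : (a - b) - (c - d) = (a - c) - (b - d).
Proof. ring. Qed.

Let ler_dist_halves (e a b c : R) :
  `|a - c| <= e / 2 -> `|b - c| <= e / 2 -> `|a - b| <= e.
Proof. by move=> ac bc; have := ler_distD c a b; rewrite (distrC c b); lra. Qed.

(** The second difference over a small parallelogram is symmetric in [v] and [w]. Divided by
    [t ^+ 2] it is a value of each mixed derivative near [x], and by continuity this value is within
    [e / 2] of both mixed derivatives at [x]. *)
Lemma schwarz (V : normedModType R) (U : set V) (h : V -> R) (x v w : V) :
  open U -> U x ->
  (forall y, U y -> derivable h y v) -> (forall y, U y -> derivable h y w) ->
  (forall y, U y -> derivable ('D_v h) y w) ->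
  (forall y, U y -> derivable ('D_w h) y v) ->
  {for x, continuous ('D_w ('D_v h))} -> {for x, continuous ('D_v ('D_w h))} ->
  'D_w ('D_v h) x = 'D_v ('D_w h) x.
Proof.
move=> oU Ux hv hw hvw hwv cvw cwv.
apply/eqP; rewrite -subr_eq0 -normr_le0; apply/ler_addgt0Pl => e e0.
rewrite addr0; have e20 : 0 < e / 2 by rewrite divr_gt0.
have /cvgrPdist_le/(_ _ e20) nvw := cvw.
have /cvgrPdist_le/(_ _ e20) nwv := cwv.
have [r r0 xr] := (nbhs_ballP _ _).1
  (filterI (open_nbhs_nbhs (conj oU Ux)) (filterI nvw nwv)).
(* With this [t] the parallelogram spanned by [t *: v] and [t *: w] stays in the ball of radius [r];
   the summand 1 covers the case [v = w = 0]. *)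
pose t := r / (`|v| + `|w| + 1).
have N0 : 0 < `|v| + `|w| + 1 by rewrite ltr_wpDl// addr_ge0.
have t0 : 0 < t by rewrite divr_gt0.
have tr s u : 0 <= s <= t -> 0 <= u <= t ->
    ball x r (x + s *: v + u *: w).
  move=> /andP[s0 st] /andP[u0 ut].
  rewrite -ball_normE /= -addrA opprD addrA subrr sub0r normrN.
  apply: (le_lt_trans (ler_normD _ _)).
  rewrite !normrZ (ger0_norm s0) (ger0_norm u0).
  apply: (@le_lt_trans _ _ (t * (`|v| + `|w|))).
    by rewrite mulrDr lerD// ler_wpM2r.
  rewrite -[ltRHS](divfK (lt0r_neq0 N0)) -/t ltr_pM2l//.
  by rewrite ltrDl.
have tr' u s : 0 <= u <= t -> 0 <= s <= t ->
    ball x r (x + u *: w + s *: v).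
  by move=> ut st; rewrite addrAC; exact: tr.
have [|s [u [st ut E]]] := @second_difference V h x v w t t0.
  move=> s u st ut; have [Uy _] := xr _ (tr _ _ st ut).
  by split; [exact: hv|exact: hvw].
have [|u' [s' [ut' st' E']]] := @second_difference V h x w v t t0.
  move=> u' s' st' ut'; have [Uy _] := xr _ (tr' _ _ st' ut').
  by split; [exact: hw|exact: hwv].
have [_ [n1 _]] := xr _ (tr _ _ st ut).
have [_ [_ n2]] := xr _ (tr' _ _ ut' st').
have E2 : (h (x + t *: v + t *: w) - h (x + t *: v)) - (h (x + t *: w) - h x) =
    (h (x + t *: w + t *: v) - h (x + t *: w)) - (h (x + t *: v) - h x).
  by rewrite (addrAC x (t *: w)); exact: second_difference_sym.
have /(mulfI (lt0r_neq0 t0))/(mulfI (lt0r_neq0 t0)) EE :=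
  etrans (esym E) (etrans E2 E').
by move: n1; rewrite /= EE => n1; exact: ler_dist_halves n1 n2.
Qed.

Lemma derive_coord (V : normedModType R) m n (f : V -> 'M[R]_(m, n)) (x v : V) i j :
  derivable f x v -> 'D_v (fun y => f y i j) x = 'D_v f x i j.
Proof. by move=> fd; rewrite derive_mx// mxE. Qed.

Lemma near_eq_in (V : normedModType R) (T : Type) (U : set V) (f g : V -> T) x :
  open U -> U x -> (forall y, U y -> f y = g y) -> {near x, f =1 g}.
Proof.
move=> oU Ux fg; apply: filterS (open_nbhs_nbhs (conj oU Ux)).
by move=> y /fg.
Qed.

(** [schwarz] is applied to each entry. Entries commute with derivatives at the points of [U], so
    derivability and continuity are transferred through equality near a point. *)
Lemma schwarz_mx (V : normedModType R) m n (U : set V) (f : V -> 'M[R]_(m, n))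
    (x v w : V) :
  open U -> U x ->
  (forall y, U y -> derivable f y v) -> (forall y, U y -> derivable f y w) ->
  (forall y, U y -> derivable ('D_v f) y w) ->
  (forall y, U y -> derivable ('D_w f) y v) ->
  {for x, continuous ('D_w ('D_v f))} -> {for x, continuous ('D_v ('D_w f))} ->
  'D_w ('D_v f) x = 'D_v ('D_w f) x.
Proof.
move=> oU Ux fv fw fvw fwv cvw cwv; apply/matrixP => i j.
pose h y := f y i j.
have co y z : derivable f y z -> derivable h y z.
  by move=> fd; exact: (derivable_mxP _ _ _).1 fd i j.
have hE y z : U y -> (forall y, U y -> derivable f y z) ->
    'D_z h y = ('D_z f y) i j.
  by move=> Uy fz; exact: (derive_coord i j (fz y Uy)).
have hEE y z z' : U y -> (forall y, U y -> derivable f y z) ->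
    (forall y, U y -> derivable ('D_z f) y z') ->
    derivable ('D_z h) y z' /\ 'D_z' ('D_z h) y = ('D_z' ('D_z f) y) i j.
  move=> Uy fz fz'.
  have N : {near y, (fun y => ('D_z f y) i j) =1 'D_z h}.
    by apply: (near_eq_in oU Uy) => y' Uy'; rewrite hE.
  split; last first.
    rewrite -(derive_coord i j (fz' y Uy)); exact/esym/(near_eq_derive z' N).
  apply: (near_eq_derivable N).
  exact: (derivable_mxP _ _ _).1 (fz' y Uy) i j.
have hC z z' : (forall y, U y -> derivable f y z) ->
    (forall y, U y -> derivable ('D_z f) y z') ->
    {for x, continuous ('D_z' ('D_z f))} ->
    {for x, continuous ('D_z' ('D_z h))}.
  move=> fz fz' cz; rewrite /prop_for /continuous_at.
  rewrite (hEE x z z' Ux fz fz').2.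
  apply: (@cvg_trans _ ((fun y => ('D_z' ('D_z f) y) i j) @ x)).
    apply: near_eq_cvg; apply: (near_eq_in oU Ux) => y Uy.
    by rewrite (hEE y z z' Uy fz fz').2.
  apply: (@cvg_comp _ _ _ ('D_z' ('D_z f)) (fun M : 'M[R]_(m, n) => M i j) _
    (nbhs ('D_z' ('D_z f) x))) => //.
  exact: coord_continuous.
apply: etrans (esym (hEE x v w Ux fv fvw).2) _.
apply: etrans (hEE x w v Ux fw fwv).2.
apply: (@schwarz V U h x v w oU Ux).
- by move=> y /fv/co.
- by move=> y /fw/co.
- by move=> y Uy; have [] := hEE y v w Uy fv fvw.
- by move=> y Uy; have [] := hEE y w v Uy fw fwv.
- exact: hC.
- exact: hC.
Qed.

Lemma is_derive_mx (V : normedModType R) m n (f : V -> 'M[R]_(m, n)) (x v : V)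
    (df : 'M[R]_(m, n)) :
  is_derive x v f df <-> forall i j, is_derive x v (fun y => f y i j) (df i j).
Proof.
split=> [fd i j|fd].
  split; last by rewrite (derive_coord i j (@ex_derive _ _ _ _ _ _ _ fd)) derive_val.
  exact: (derivable_mxP _ _ _).1 (@ex_derive _ _ _ _ _ _ _ fd) i j.
have fd' : derivable f x v by apply/derivable_mxP => i j; have [] := fd i j.
split => //; apply/matrixP => i j.
by rewrite -(derive_coord i j fd'); have [] := fd i j.
Qed.

End Calculus.

(** * Gauss equation of a spherical factor *)

Section DotProduct.
Context {R : realType}.

Lemma dotvE k (v w : 'rV[R]_k) : dotv v w = (v *m w^T) ord0 ord0.
Proof. by rewrite mxE; apply: eq_bigr => i _; rewrite mxE. Qed.

Lemma dotvC k (v w : 'rV[R]_k) : dotv v w = dotv w v.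
Proof. by apply: eq_bigr => i _; rewrite mulrC. Qed.

Lemma dotvDl k (u v w : 'rV[R]_k) : dotv (u + v) w = dotv u w + dotv v w.
Proof. by rewrite !dotvE mulmxDl mxE. Qed.

Lemma dotvZl k (a : R) (v w : 'rV[R]_k) : dotv (a *: v) w = a * dotv v w.
Proof. by rewrite !dotvE -scalemxAl mxE. Qed.

Lemma dotvBl k (u v w : 'rV[R]_k) : dotv (u - v) w = dotv u w - dotv v w.
Proof. by rewrite -scaleN1r dotvDl dotvZl mulN1r. Qed.

Lemma dotv_suml k n (f : 'I_n -> 'rV[R]_k) (w : 'rV[R]_k) :
  dotv (\sum_i f i) w = \sum_i dotv (f i) w.
Proof.
rewrite dotvE mulmx_suml summxE.
by apply: eq_bigr => i _; rewrite dotvE.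
Qed.

Lemma gramE n k (v : 'I_n -> 'rV[R]_k) i j :
  ((\matrix_l v l) *m (\matrix_l v l)^T) i j = dotv (v i) (v j).
Proof. by rewrite mxE; apply: eq_bigr => l _; rewrite !mxE. Qed.

Lemma is_derive_dotv (V : normedModType R) k (f g : V -> 'rV[R]_k) (x v : V)
    (df dg : 'rV[R]_k) :
  is_derive x v f df -> is_derive x v g dg ->
  is_derive x v (fun y => dotv (f y) (g y)) (dotv df (g x) + dotv (f x) dg).
Proof.
move=> /is_derive_mx fd /is_derive_mx gd.
rewrite /dotv -big_split; apply: is_derive_sumE => i.
apply: (is_derive_eq (is_deriveM (fd ord0 i) (gd ord0 i))).
by rewrite addrC /GRing.scale /= [_ * df _ _]mulrC.
Qed.

End DotProduct.

Section SphereFactor.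
Context {R : realType} {n m : nat}.
Variable U : set 'rV[R]_n.
Variables (P : 'rV[R]_n -> 'rV[R]_m) (P1 : 'I_n -> 'rV[R]_n -> 'rV[R]_m).
Variables (P2 : 'I_n -> 'I_n -> 'rV[R]_n -> 'rV[R]_m).
Variables (P3 : 'I_n -> 'I_n -> 'I_n -> 'rV[R]_n -> 'rV[R]_m).

Notation dd i := (delta_mx ord0 i : 'rV[R]_n).

(* P1, P2, P3 are the partial derivatives of P of orders 1, 2, 3 at the points
   of U; as data they need not agree with iterated partial derivatives outside
   U, which makes jets stable under lsubmx and rsubmx. *)
Record jet3_on : Prop := Jet3On {
  jet_d1 : forall i y, U y -> is_derive y (dd i) P (P1 i y);
  jet_d2 : forall i j y, U y -> is_derive y (dd i) (P1 j) (P2 i j y);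
  jet_d3 : forall i j k y, U y -> is_derive y (dd i) (P2 j k) (P3 i j k y);
  jet_sym2 : forall i j y, U y -> P2 i j y = P2 j i y;
  jet_sym3 : forall i j k y, U y -> P3 i j k y = P3 j i k y }.

Hypothesis oU : open U.
Hypothesis J : jet3_on.
Hypothesis PP : forall y, U y -> dotv (P y) (P y) = 1.

(** Differentiate [dotv (P y) (P y) = 1]; the two resulting terms are equal. *)
Lemma normal_tangent i y : U y -> dotv (P y) (P1 i y) = 0.
Proof.
move=> Uy; have D := is_derive_dotv (jet_d1 J i Uy) (jet_d1 J i Uy).
have N : {near y, (fun y => dotv (P y) (P y)) =1 cst 1}.
  by apply: (near_eq_in oU Uy) => z Uz; rewrite PP.
have := near_eq_derive (dd i) N; rewrite derive_val derive_cst dotvC; lra.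
Qed.

(** Differentiate the relation of [normal_tangent] once more. *)
Lemma normal_second i j y : U y ->
  dotv (P y) (P2 i j y) = - dotv (P1 i y) (P1 j y).
Proof.
move=> Uy; have D := is_derive_dotv (jet_d1 J i Uy) (jet_d2 J i j Uy).
have N : {near y, (fun y => dotv (P y) (P1 j y)) =1 cst 0}.
  by apply: (near_eq_in oU Uy) => z Uz; rewrite normal_tangent.
have := near_eq_derive (dd i) N; rewrite derive_val derive_cst; lra.
Qed.

(** [Gam] is abstract because both factors will use the Christoffel symbols of the whole metric: the
    form [a] of a single factor may be degenerate and then has no symbols of its own. *)
Variable Gam : 'I_n -> 'I_n -> 'I_n -> 'rV[R]_n -> R.
Hypothesis dGam : forall l i j s y, U y -> derivable (Gam l i j) y (dd s).
Hypothesis gauss : forall j k y, U y ->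
  P2 j k y = \sum_l Gam l j k y *: P1 l y - dotv (P1 j y) (P1 k y) *: P y.

Let a j k y := dotv (P1 j y) (P1 k y).

Lemma gauss_dot j k s y : U y ->
  dotv (P2 j k y) (P1 s y) = \sum_l Gam l j k y * a l s y.
Proof.
move=> Uy; rewrite gauss// dotvBl dotvZl normal_tangent// mulr0 subr0.
by rewrite dotv_suml; apply: eq_bigr => l _; rewrite dotvZl.
Qed.

(** Differentiate [gauss_dot] in direction [i], then expand each second derivative [P2 i l] by
    [gauss_dot] again. *)
Lemma third_dot i j k s y : U y ->
  dotv (P3 i j k y) (P1 s y) =
  \sum_l (pder i (Gam l j k) y + \sum_m Gam l i m y * Gam m j k y) * a l s y
  - a j k y * a i s y.
Proof.
move=> Uy.
have DL := is_derive_dotv (jet_d3 J i j k Uy) (jet_d2 J i s Uy).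
have DR : is_derive y (dd i) (fun y => \sum_l Gam l j k y * a l s y)
  (\sum_l (Gam l j k y *: (dotv (P2 i l y) (P1 s y) + dotv (P1 l y) (P2 i s y))
    + a l s y *: pder i (Gam l j k) y)).
  apply: is_derive_sumE => l; apply: is_deriveM.
    by apply: derivableP; exact: dGam.
  exact: is_derive_dotv (jet_d2 J i l Uy) (jet_d2 J i s Uy).
have N : {near y, (fun y => dotv (P2 j k y) (P1 s y)) =1
                  (fun y => \sum_l Gam l j k y * a l s y)}.
  by apply: (near_eq_in oU Uy) => z Uz; exact: gauss_dot.
have := near_eq_derive (dd i) N; rewrite (@derive_val _ _ _ _ _ _ _ DL).
rewrite (@derive_val _ _ _ _ _ _ _ DR).
(* The normal part of [P2 j k], paired with [P2 i s], produces [a j k y * a i s y]. *)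
rewrite [in dotv (P2 j k y)](gauss j k Uy) dotvBl dotvZl normal_second//.
rewrite dotv_suml mulrN opprK -/(a i s y) -/(a j k y) => E.
have {E} -> : dotv (P3 i j k y) (P1 s y) =
  \sum_l (Gam l j k y * dotv (P2 i l y) (P1 s y)
          + pder i (Gam l j k) y * a l s y) - a j k y * a i s y.
  apply/eqP; rewrite -(subr_eq _ _ (- _)) opprK; apply/eqP.
  (* The terms [Gam l j k y * dotv (P1 l y) (P2 i s y)] occur on both sides of [E] and cancel. *)
  apply: (addIr (\sum_l dotv (Gam l j k y *: P1 l y) (P2 i s y))).
  rewrite -addrA [_ * _ + _]addrC E -big_split; apply: eq_bigr => l _.
  by rewrite dotvZl /GRing.scale /=; ring.
congr (_ - _).
rewrite big_split /=; under [RHS]eq_bigr do rewrite mulrDl.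
rewrite [RHS]big_split /= addrC; congr (_ + _).
under eq_bigr do rewrite (gauss_dot _ _ _ Uy) big_distrr.
under [RHS]eq_bigr do rewrite big_distrl.
rewrite /= exchange_big; apply: eq_bigr => l _; apply: eq_bigr => m' _ /=.
by rewrite mulrCA mulrA.
Qed.

(* The Gauss equation: third_dot gives two expressions of the tangential part of
   P3 i j k = P3 j i k. *)
Lemma curvature_dot i j k s y : U y ->
  \sum_l (pder i (Gam l j k) y - pder j (Gam l i k) y
    + \sum_m (Gam l i m y * Gam m j k y - Gam l j m y * Gam m i k y)) * a l s y
  = a j k y * a i s y - a i k y * a j s y.
Proof.
move=> Uy; have := third_dot j i k s Uy.
rewrite -(jet_sym3 J) // (third_dot i j k s Uy) => E.
transitivity (\sum_l (pder i (Gam l j k) y + \sum_m Gam l i m y * Gam m j k y) * a l s y -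
  \sum_l (pder j (Gam l i k) y + \sum_m Gam l j m y * Gam m i k y) * a l s y).
  rewrite -sumrB; apply: eq_bigr => l _.
  by rewrite sumrB -mulrBl; congr (_ * _); ring.
by move: E; lra.
Qed.

End SphereFactor.

(** * Curvature of a product of spheres *)

Section ProductOfSpheres.
Context {R : realType} {n m1 m2 : nat}.
Variable U : set 'rV[R]_n.
Variables (P : 'rV[R]_n -> 'rV[R]_m1) (P1 : 'I_n -> 'rV[R]_n -> 'rV[R]_m1).
Variables (P2 : 'I_n -> 'I_n -> 'rV[R]_n -> 'rV[R]_m1).
Variables (P3 : 'I_n -> 'I_n -> 'I_n -> 'rV[R]_n -> 'rV[R]_m1).
Variables (Q : 'rV[R]_n -> 'rV[R]_m2) (Q1 : 'I_n -> 'rV[R]_n -> 'rV[R]_m2).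
Variables (Q2 : 'I_n -> 'I_n -> 'rV[R]_n -> 'rV[R]_m2).
Variables (Q3 : 'I_n -> 'I_n -> 'I_n -> 'rV[R]_n -> 'rV[R]_m2).
Variables (c : R) (g : 'rV[R]_n -> 'M[R]_n).

Notation dd i := (delta_mx ord0 i : 'rV[R]_n).

Hypotheses (oU : open U) (c_gt0 : 0 < c).
Hypothesis dimE : (n + (1 + 1) = m1 + m2)%N.
Hypotheses (JP : jet3_on U P P1 P2 P3) (JQ : jet3_on U Q Q1 Q2 Q3).
Hypothesis PP : forall y, U y -> dotv (P y) (P y) = 1.
Hypothesis QQ : forall y, U y -> dotv (Q y) (Q y) = 1.

Let A1 y : 'M[R]_(n, m1) := \matrix_i P1 i y.
Let A2 y : 'M[R]_(n, m2) := \matrix_i Q1 i y.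
Let a y := A1 y *m (A1 y)^T.
Let b y := A2 y *m (A2 y)^T.

Hypothesis immersion : forall y, U y -> row_free (row_mx (A1 y) (A2 y)).
Hypothesis gE : forall y, U y -> g y = a y + c *: b y.

Let aE y i j : a y i j = dotv (P1 i y) (P1 j y).
Proof. exact: gramE. Qed.

Let bE y i j : b y i j = dotv (Q1 i y) (Q1 j y).
Proof. exact: gramE. Qed.

Let gijE y i j : U y ->
  g y i j = dotv (P1 i y) (P1 j y) + c * dotv (Q1 i y) (Q1 j y).
Proof. by move=> Uy; rewrite gE// !mxE -aE -bE !mxE. Qed.

Let PA1 y : U y -> P y *m (A1 y)^T = 0.
Proof.
move=> Uy; apply/rowP => i; rewrite [RHS]mxE -(normal_tangent oU JP PP i Uy).
by rewrite mxE; apply: eq_bigr => k _; rewrite !mxE.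
Qed.

Let QA2 y : U y -> Q y *m (A2 y)^T = 0.
Proof.
move=> Uy; apply/rowP => i; rewrite [RHS]mxE -(normal_tangent oU JQ QQ i Uy).
by rewrite mxE; apply: eq_bigr => k _; rewrite !mxE.
Qed.

Let mulmx_trE k (v w : 'rV[R]_k) : v *m w^T = (dotv v w)%:M.
Proof. by rewrite dotvE -mx11_scalar. Qed.

Let PP1 y : U y -> P y *m (P y)^T = 1%:M.
Proof. by move=> Uy; rewrite mulmx_trE PP. Qed.

Let QQ1 y : U y -> Q y *m (Q y)^T = 1%:M.
Proof. by move=> Uy; rewrite mulmx_trE QQ. Qed.

Lemma metric_unit y : U y -> g y \in unitmx.
Proof. by move=> Uy; rewrite gE//; apply: gram_unit => //; exact: immersion. Qed.

Let completeness y : U y ->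
  [/\ (A1 y)^T *m ginv g y *m A1 y = 1%:M - (P y)^T *m P y,
      (A1 y)^T *m ginv g y *m A2 y = 0,
      (A2 y)^T *m ginv g y *m A1 y = 0 &
      c *: ((A2 y)^T *m ginv g y *m A2 y) = 1%:M - (Q y)^T *m Q y].
Proof.
move=> Uy; rewrite /ginv gE//.
exact: (gram_completeness c_gt0 dimE (immersion Uy) (PA1 Uy) (QA2 Uy)
  (PP1 Uy) (QQ1 Uy)).
Qed.

Let ginv_sym y : U y -> (ginv g y)^T = ginv g y.
Proof.
move=> Uy; rewrite /ginv trmx_inv; congr (invmx _).
by apply/matrixP => i j; rewrite mxE !gijE// dotvC [dotv (Q1 j y) _]dotvC.
Qed.

Lemma metric_derive i j k y : U y -> is_derive y (dd i) (fun z => g z j k)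
  ((dotv (P2 i j y) (P1 k y) + dotv (P1 j y) (P2 i k y)) +
   c * (dotv (Q2 i j y) (Q1 k y) + dotv (Q1 j y) (Q2 i k y))).
Proof.
move=> Uy.
have N : {near y, (fun z => dotv (P1 j z) (P1 k z)
                            + c * dotv (Q1 j z) (Q1 k z)) =1
                  (fun z => g z j k)}.
  by apply: (near_eq_in oU Uy) => z Uz; rewrite gijE.
apply: (near_eq_is_derive N).
have DP := is_derive_dotv (jet_d2 JP i j Uy) (jet_d2 JP i k Uy).
have DQ := is_derive_dotv (jet_d2 JQ i j Uy) (jet_d2 JQ i k Uy).
exact: is_deriveD DP (is_deriveZ c DQ).
Qed.

(* Christoffel symbols of the first kind *)
Let lower i j l y :=
  dotv (P2 i j y) (P1 l y) + c * dotv (Q2 i j y) (Q1 l y).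

(** By symmetry of second derivatives, the products of [P1 i] or [P1 j] with a second derivative
    cancel in the sum of metric derivatives; what remains is twice [lower]. *)
Lemma christoffelE k i j y : U y ->
  christoffel g k i j y = \sum_l ginv g y k l * lower i j l y.
Proof.
move=> Uy; rewrite /christoffel big_distrr; apply: eq_bigr => l _ /=.
rewrite mulrCA; congr (_ * _); rewrite /pder.
rewrite !(@derive_val _ _ _ _ _ _ _ (metric_derive _ _ _ Uy)).
rewrite (jet_sym2 JP j i Uy) (jet_sym2 JP l i Uy) (jet_sym2 JP l j Uy).
rewrite (jet_sym2 JQ j i Uy) (jet_sym2 JQ l i Uy) (jet_sym2 JQ l j Uy).
rewrite /lower (dotvC (P1 j y) (P2 i l y)) (dotvC (Q1 j y) (Q2 i l y)).
by field.
Qed.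

Lemma derivable_christoffel k i j s y : U y ->
  derivable (christoffel g k i j) y (dd s).
Proof.
move=> Uy.
apply: (@near_eq_derivable _ _ _
  (fun z => \sum_l ginv g z k l * lower i j l z)).
  by apply: (near_eq_in oU Uy) => z Uz; rewrite christoffelE.
apply: derivable_bigsum => l.
have D1 : derivable (fun z => ginv g z k l) y (dd s).
  apply: derivable_invmx => [i' j'|]; first by have [] := metric_derive s i' j' Uy.
  by apply: filterS (open_nbhs_nbhs (conj oU Uy)) => z /metric_unit.
have [DP _] := is_derive_dotv (jet_d3 JP s i j Uy) (jet_d2 JP s l Uy).
have [DQ _] := is_derive_dotv (jet_d3 JQ s i j Uy) (jet_d2 JQ s l Uy).
exact: (derivableM D1 (derivableD DP (derivableZ (k := c) DQ))).
Qed.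

Let christoffel_row i j y : U y -> (\row_k christoffel g k i j y) =
  (P2 i j y *m (A1 y)^T + c *: (Q2 i j y *m (A2 y)^T)) *m ginv g y.
Proof.
move=> Uy; apply/rowP => k; rewrite mxE christoffelE// mxE.
apply: eq_bigr => l _; rewrite mulrC -[in RHS](ginv_sym Uy) [in RHS]mxE.
rewrite !mxE; congr (_ * _); rewrite /lower /dotv; congr (_ + _ * _);
  by apply: eq_bigr => s _; rewrite !mxE.
Qed.

(** By [completeness], multiplying the row of Christoffel symbols by [A1] projects [P2 i j] onto the
    orthogonal complement of [P], and the vanishing mixed block removes [Q2]. The normal part is
    given by [normal_second]. *)
Lemma gauss_left i j y : U y ->
  P2 i j y = \sum_l christoffel g l i j y *: P1 l y
             - dotv (P1 i y) (P1 j y) *: P y.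
Proof.
move=> Uy; have [E1 _ E3 _] := completeness Uy.
have -> : \sum_l christoffel g l i j y *: P1 l y =
    (\row_k christoffel g k i j y) *m A1 y.
  by rewrite mulmx_sum_row; apply: eq_bigr => l _; rewrite rowK mxE.
rewrite christoffel_row// !mulmxDl -!scalemxAl -!mulmxA.
rewrite [_^T *m (_ *m _)]mulmxA [(A2 y)^T *m (_ *m _)]mulmxA E1 E3 mulmx0 scaler0 addr0.
rewrite mulmxBr mulmx1 mulmxA mulmx_trE mul_scalar_mx.
by rewrite dotvC (normal_second oU JP PP)// scaleNr opprK addrK.
Qed.

Lemma gauss_right i j y : U y ->
  Q2 i j y = \sum_l christoffel g l i j y *: Q1 l y
             - dotv (Q1 i y) (Q1 j y) *: Q y.
Proof.
move=> Uy; have [_ E2 _ E4] := completeness Uy.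
have -> : \sum_l christoffel g l i j y *: Q1 l y =
    (\row_k christoffel g k i j y) *m A2 y.
  by rewrite mulmx_sum_row; apply: eq_bigr => l _; rewrite rowK mxE.
rewrite christoffel_row// !mulmxDl -!scalemxAl -!mulmxA.
rewrite [(A1 y)^T *m (_ *m _)]mulmxA [(A2 y)^T *m (_ *m _)]mulmxA E2 mulmx0 add0r.
rewrite scalemxAr E4 mulmxBr mulmx1 mulmxA mulmx_trE mul_scalar_mx.
by rewrite dotvC (normal_second oU JQ QQ)// scaleNr opprK addrK.
Qed.

(** * Riemann and Ricci tensors *)

Let row_mulE (f : 'I_n -> R) (M : 'M[R]_n) s :
  ((\row_l f l) *m M) ord0 s = \sum_l f l * M l s.
Proof. by rewrite mxE; apply: eq_bigr => l _; rewrite mxE. Qed.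

Let row_combE (x z : R) (M : 'M[R]_n) i j s :
  (x *: row i M - z *: row j M) ord0 s = x * M i s - z * M j s.
Proof. by rewrite !mxE. Qed.

(** Lowering the upper index with [g], that is with [a] and [c *: b] separately, reduces the claim
    to [curvature_dot] on each factor. *)
Let riemann_row i j k y : U y -> (\row_l riemann g l i j k y) =
  (a y j k *: row i (a y) - a y i k *: row j (a y)
   + c *: (b y j k *: row i (b y) - b y i k *: row j (b y))) *m ginv g y.
Proof.
move=> Uy; rewrite -[LHS](mulmxK (metric_unit Uy)); congr (_ *m _).
rewrite {1}gE// mulmxDr -scalemxAr; congr (_ + _ *: _); apply/rowP => s.
  rewrite row_mulE row_combE !aE.
  rewrite -(curvature_dot oU JP PP derivable_christoffel gauss_left i j k s Uy).
  by apply: eq_bigr => l _; rewrite aE.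
rewrite row_mulE row_combE !bE.
rewrite -(curvature_dot oU JQ QQ derivable_christoffel gauss_right i j k s Uy).
by apply: eq_bigr => l _; rewrite bE.
Qed.

Let gtrace_mx (T : 'M[R]_n) y : gtrace g T y = \tr (ginv g y *m T^T).
Proof.
by apply: eq_bigr => i _; rewrite mxE; apply: eq_bigr => j _; rewrite mxE.
Qed.

Let a_sym y : (a y)^T = a y. Proof. by rewrite trmx_mul trmxK. Qed.
Let b_sym y : (b y)^T = b y. Proof. by rewrite trmx_mul trmxK. Qed.

Let tr_normal k (v : 'rV[R]_k) : v *m v^T = 1%:M ->
  \tr (1%:M - v^T *m v) = k%:R - 1.
Proof. by move=> v1; rewrite raddfB /= mxtrace1 mxtrace_mulC v1 mxtrace1. Qed.

(** By cyclicity this is the trace of the projection onto the complement of the unit vector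
    [P y]. *)
Let tr_left y : U y -> \tr (ginv g y *m a y) = m1%:R - 1.
Proof.
move=> Uy; have [E1 _ _ _] := completeness Uy.
by rewrite /a mulmxA mxtrace_mulC mulmxA E1 tr_normal// PP1.
Qed.

Let tr_right y : U y -> c * \tr (ginv g y *m b y) = m2%:R - 1.
Proof.
move=> Uy; have [_ _ _ E4] := completeness Uy.
by rewrite /b mulmxA mxtrace_mulC mulmxA -mxtraceZ E4 tr_normal// QQ1.
Qed.

(** The middle factor is the projection along [P y], which fixes the rows of [A1 y] because they are
    orthogonal to [P y]. *)
Let proj_left y : U y -> a y *m ginv g y *m a y = a y.
Proof.
move=> Uy; have [E1 _ _ _] := completeness Uy.
have -> : a y *m ginv g y *m a y =
    A1 y *m ((A1 y)^T *m ginv g y *m A1 y) *m (A1 y)^T.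
  by rewrite /a !mulmxA.
rewrite E1 mulmxBr mulmx1 mulmxBl -mulmxA -[_^T *m _ *m _]mulmxA PA1//.
by rewrite !mulmx0 subr0.
Qed.

Let proj_right y : U y -> c *: (b y *m ginv g y *m b y) = b y.
Proof.
move=> Uy; have [_ _ _ E4] := completeness Uy.
have -> : c *: (b y *m ginv g y *m b y) =
    A2 y *m (c *: ((A2 y)^T *m ginv g y *m A2 y)) *m (A2 y)^T.
  by rewrite -scalemxAr -scalemxAl /b !mulmxA.
rewrite E4 mulmxBr mulmx1 mulmxBl -mulmxA -[_^T *m _ *m _]mulmxA QA2//.
by rewrite !mulmx0 subr0.
Qed.

Let trace_row (M N : 'M[R]_n) j k :
  \sum_i ((M j k *: row i M - M i k *: row j M) *m N) ord0 i =
  (\tr (M *m N) *: M - M *m N *m M) j k.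
Proof.
rewrite !mxE mulrC /mxtrace big_distrr -sumrB; apply: eq_bigr => i _ /=.
rewrite mulmxBl -!scalemxAl -!row_mul !mxE.
by congr (_ - _); rewrite mulrC.
Qed.

(** In each factor the contraction leaves a trace times the form minus the form: [m1 - 1] minus 1
    for [a], and [m2 - 1] minus 1 for [b], where the weight [c] is absorbed by [tr_right] and
    [proj_right]. *)
Lemma ricci_product y : U y ->
  ricci g y = (m1%:R - 2) *: a y + (m2%:R - 2) *: b y.
Proof.
move=> Uy; apply/matrixP => j k; rewrite mxE.
have R1 i : riemann g i i j k y =
   ((a y j k *: row i (a y) - a y i k *: row j (a y)) *m ginv g y) ord0 i
   + c * ((b y j k *: row i (b y) - b y i k *: row j (b y)) *m ginv g y) ord0 i.
  have /rowP/(_ i) := riemann_row i j k Uy.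
  by rewrite mxE mulmxDl -scalemxAl => ->; rewrite mxE [X in _ + X]mxE.
under eq_bigr do rewrite R1.
rewrite big_split /= -big_distrr /= !trace_row proj_left// mxtrace_mulC tr_left//.
have E2 : c *: (\tr (b y *m ginv g y) *: b y - b y *m ginv g y *m b y) =
    (m2%:R - 2) *: b y.
  rewrite scalerBr proj_right// scalerA mxtrace_mulC tr_right//.
  by rewrite -{2}(scale1r (b y)) -scalerBl; congr (_ *: _); ring.
have E1 : (m1%:R - 1) *: a y - a y = (m1%:R - 2) *: a y.
  by rewrite -{2}(scale1r (a y)) -scalerBl; congr (_ *: _); ring.
by rewrite E1 [RHS]mxE -E2; congr (_ + _); rewrite [RHS]mxE.
Qed.

Lemma gtrace_left y : U y -> gtrace g (a y) y = m1%:R - 1.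
Proof. by move=> Uy; rewrite gtrace_mx a_sym tr_left. Qed.

Lemma gtrace_right y : U y -> c * gtrace g (b y) y = m2%:R - 1.
Proof. by move=> Uy; rewrite gtrace_mx b_sym tr_right. Qed.

(** Read coordinate [k] of [gauss_left]: its Christoffel terms are exactly those subtracted in the
    Hessian. *)
Lemma hessian_coord (F : 'rV[R]_n -> R) k y :
  (forall z, U z -> F z = P z ord0 k) -> U y -> hessian g F y = - F y *: a y.
Proof.
move=> FE Uy.
have dF j z : U z -> pder j F z = P1 j z ord0 k.
  move=> Uz; have /is_derive_mx/(_ ord0 k) D := jet_d1 JP j Uz.
  rewrite -[RHS](@derive_val _ _ _ _ _ _ _ D); apply: near_eq_derive.
  exact: (near_eq_in oU Uz FE).
apply/matrixP => i j; rewrite [LHS]mxE [RHS]mxE aE.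
have -> : pder i (pder j F) y = P2 i j y ord0 k.
  have /is_derive_mx/(_ ord0 k) D := jet_d2 JP i j Uy.
  rewrite -[RHS](@derive_val _ _ _ _ _ _ _ D); apply: near_eq_derive.
  exact: (near_eq_in oU Uy (dF j)).
rewrite gauss_left// !mxE summxE FE//.
under [X in X - _ - _]eq_bigr do rewrite mxE.
under [X in _ - X]eq_bigr do rewrite dF//.
by rewrite addrAC subrr add0r mulrC mulNr.
Qed.

Let gtrace_comb (k l : R) (S T : 'M[R]_n) y :
  gtrace g (k *: S + l *: T) y = k * gtrace g S y + l * gtrace g T y.
Proof.
by rewrite !gtrace_mx raddfD /= mulmxDr mxtraceD !linearZ.
Qed.

Hypotheses (m1_gt1 : (1 < m1)%N) (m2_gt2 : (2 < m2)%N).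
(* c (m1 - 1) = m2 - 2 is the choice c = (q-1)/(p+1) with m1 = p+2, m2 = q+1. *)
Hypothesis einstein_ratio : c * (m1%:R - 1) = m2%:R - 2.

(** The Laplacian is [- (m1 - 1) F] and the scalar curvature is [(m1 - 1) (n - 1)]; the constant in
    place of [rho] is the solution of the second equation for these values. *)
Lemma fluid_equations (F : 'rV[R]_n -> R) k y :
  (forall z, U z -> F z = P z ord0 k) -> U y ->
  F y *: traceless_ricci g y = traceless_hessian g F y /\
  laplacian g F y =
    ((n%:R - 2) / (2 * (n%:R - 1)) * scalar_curvature g y
     + n%:R / (n%:R - 1) * (- ((m1%:R - 1) * (n%:R - 1) / 2))) * F y.
Proof.
move=> FE Uy.
have nE : n%:R = m1%:R + m2%:R - 2 :> R.
  by rewrite -natrD -dimE natrD; ring.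
have n0 : n%:R != 0 :> R by rewrite pnatr_eq0; lia.
have n1 : n%:R - 1 != 0 :> R.
  by rewrite subr_eq0 pnatr_eq1; lia.
have lapE : laplacian g F y = - F y * (m1%:R - 1).
  rewrite /laplacian (hessian_coord FE Uy) -[_ *: a y]addr0 -(scale0r (b y)).
  by rewrite gtrace_comb gtrace_left// mul0r addr0.
have scalE : scalar_curvature g y = (m1%:R - 1) * (n%:R - 1).
  rewrite /scalar_curvature ricci_product// gtrace_comb gtrace_left//.
  (* The coefficient [m2 - 2] becomes [c * (m1 - 1)], whose factor [c] is the one [gtrace_right]
     needs. *)
  by rewrite -einstein_ratio mulrAC gtrace_right// nE; ring.
split; last by rewrite lapE scalE; field; rewrite n1.
(* By [einstein_ratio] the Ricci tensor is [(m1 - 1) g - a], and the Hessian is [- F a]: both sides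
   are [F] times the traceless part of [- a]. *)
rewrite /traceless_ricci /traceless_hessian lapE scalE (hessian_coord FE Uy).
rewrite ricci_product// gE// -einstein_ratio; apply/matrixP => i j.
move: (a y) (b y) => A B; rewrite !mxE; by field.
Qed.

End ProductOfSpheres.

(** * Jets of smooth maps and of their two components *)

Section Jets.
Context {R : realType} {n : nat}.
Variable U : set 'rV[R]_n.
Hypothesis oU : open U.

Notation dd i := (delta_mx ord0 i : 'rV[R]_n).

(** Both symmetries come from [schwarz_mx], applied to [phi] and to [pder k phi]; the mixed
    derivatives are continuous because they are differentiable. *)
Lemma smooth_jet m (phi : 'rV[R]_n -> 'rV[R]_m) : smooth_on U phi ->
  jet3_on U phi (fun i => pder i phi) (fun i j => pder i (pder j phi))
    (fun i j k => pder i (pder j (pder k phi))).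
Proof.
move=> sm.
have d0 y : U y -> differentiable phi y by move=> /(sm [::]).
have d1 i y : U y -> differentiable (pder i phi) y by move=> /(sm [:: i]).
have d2 i j y : U y -> differentiable (pder i (pder j phi)) y.
  by move=> /(sm [:: i; j]).
have d3 i j k y : U y -> differentiable (pder i (pder j (pder k phi))) y.
  by move=> /(sm [:: i; j; k]).
split.
- by move=> i y Uy; apply/derivableP/diff_derivable/d0.
- by move=> i j y Uy; apply/derivableP/diff_derivable/d1.
- by move=> i j k y Uy; apply/derivableP/diff_derivable/d2.
- move=> i j y Uy; apply: (@schwarz_mx R _ _ _ U phi y (dd j) (dd i) oU Uy).
  + by move=> z Uz; apply/diff_derivable/d0.
  + by move=> z Uz; apply/diff_derivable/d0.
  + by move=> z Uz; apply/diff_derivable/(d1 j).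
  + by move=> z Uz; apply/diff_derivable/(d1 i).
  + exact: differentiable_continuous (d2 i j _ Uy).
  + exact: differentiable_continuous (d2 j i _ Uy).
- move=> i j k y Uy.
  apply: (@schwarz_mx R _ _ _ U (pder k phi) y (dd j) (dd i) oU Uy).
  + by move=> z Uz; apply/diff_derivable/d1.
  + by move=> z Uz; apply/diff_derivable/d1.
  + by move=> z Uz; apply/diff_derivable/(d2 j k).
  + by move=> z Uz; apply/diff_derivable/(d2 i k).
  + exact: differentiable_continuous (d3 i j k _ Uy).
  + exact: differentiable_continuous (d3 j i k _ Uy).
Qed.

Lemma is_derive_lsubmx (V : normedModType R) k l (f : V -> 'rV[R]_(k + l)) x v df :
  is_derive x v f df -> is_derive x v (fun y => lsubmx (f y)) (lsubmx df).
Proof.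
move=> /is_derive_mx fd; apply/is_derive_mx => i j; rewrite mxE.
by under eq_fun do rewrite mxE; exact: fd.
Qed.

Lemma is_derive_rsubmx (V : normedModType R) k l (f : V -> 'rV[R]_(k + l)) x v df :
  is_derive x v f df -> is_derive x v (fun y => rsubmx (f y)) (rsubmx df).
Proof.
move=> /is_derive_mx fd; apply/is_derive_mx => i j; rewrite mxE.
by under eq_fun do rewrite mxE; exact: fd.
Qed.

Variables (k l : nat) (P : 'rV[R]_n -> 'rV[R]_(k + l)).
Variables (P1 : 'I_n -> 'rV[R]_n -> 'rV[R]_(k + l)).
Variables (P2 : 'I_n -> 'I_n -> 'rV[R]_n -> 'rV[R]_(k + l)).
Variables (P3 : 'I_n -> 'I_n -> 'I_n -> 'rV[R]_n -> 'rV[R]_(k + l)).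

Lemma jet_lsubmx : jet3_on U P P1 P2 P3 ->
  jet3_on U (fun y => lsubmx (P y)) (fun i y => lsubmx (P1 i y))
    (fun i j y => lsubmx (P2 i j y)) (fun i j k y => lsubmx (P3 i j k y)).
Proof.
case=> d1 d2 d3 s2 s3; split.
- by move=> i y /d1 D; exact: is_derive_lsubmx.
- by move=> i j y Uy; exact: is_derive_lsubmx (d2 i j y Uy).
- by move=> i j m y Uy; exact: is_derive_lsubmx (d3 i j m y Uy).
- by move=> i j y /s2 ->.
- by move=> i j m y Uy; rewrite s3.
Qed.

Lemma jet_rsubmx : jet3_on U P P1 P2 P3 ->
  jet3_on U (fun y => rsubmx (P y)) (fun i y => rsubmx (P1 i y))
    (fun i j y => rsubmx (P2 i j y)) (fun i j k y => rsubmx (P3 i j k y)).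
Proof.
case=> d1 d2 d3 s2 s3; split.
- by move=> i y /d1 D; exact: is_derive_rsubmx.
- by move=> i j y Uy; exact: is_derive_rsubmx (d2 i j y Uy).
- by move=> i j m y Uy; exact: is_derive_rsubmx (d3 i j m y Uy).
- by move=> i j y /s2 ->.
- by move=> i j m y Uy; rewrite s3.
Qed.

End Jets.

(** * The warped metric on tangent vectors *)

Section WarpedMetric.
Context {R : realType} {p : nat}.
Implicit Types x v w : 'rV[R]_p.+2.

Let tail x : 'rV[R]_p.+1 := \row_(j < p.+1) x ord0 (lift ord0 j).

Lemma dotv_recl v w :
  dotv v w = v ord0 ord0 * w ord0 ord0 + dotv (tail v) (tail w).
Proof.
by rewrite /dotv big_ord_recl; congr (_ + _); apply: eq_bigr => i _; rewrite !mxE.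
Qed.

Lemma sphere_coord_itv x : dotv x x = 1 -> -1 <= x ord0 ord0 <= 1.
Proof.
rewrite dotv_recl => xx.
have : 0 <= dotv (tail x) (tail x) by rewrite dotvE row_mulmx_tr_ge0.
by move: xx; set t := dotv _ _; set z := x _ _ => xx t0; apply/andP; split; nra.
Qed.

Lemma is_derive_comp_coord (V : normedModType R) (f : R -> R) (df : R)
    (u : V -> R) (y v : V) :
  differentiable u y -> is_derive (u y) 1 f df ->
  is_derive y v (fun z => f (u z)) (df * 'D_v u y).
Proof.
move=> du fd; have fd' : differentiable f (u y).
  by apply/derivable1_diffP; have [] := fd.
have D : differentiable (f \o u) y by exact: differentiable_comp.
split; first exact: diff_derivable.
have E : 'd f (u y) 1 = df by rewrite -deriveE//; have [] := fd.
rewrite (deriveE v D) diff_comp//= (deriveE v du).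
move: ('d u y v) => t.
have -> : t = t *: (1 : R) by rewrite /GRing.scale /= mulr1.
by rewrite linearZ /= E /GRing.scale /= mulr1 mulrC.
Qed.

Lemma is_derive_coord k i (x v : 'rV[R]_k) :
  is_derive x v (fun z : 'rV[R]_k => z ord0 i) (v ord0 i).
Proof.
split; first exact/diff_derivable/differentiable_coord.
by rewrite (@derive_coord _ _ _ _ id) ?derive_id//; exact: derivable_id.
Qed.

Let warped_identity (s x0 v0 w0 xv xw xx vw : R) :
  s != 0 -> s ^+ 2 = 1 - x0 ^+ 2 -> xx = s ^+ 2 ->
  xv = - x0 * v0 -> xw = - x0 * w0 ->
  (- s^-1 * v0) * (- s^-1 * w0) +
  s ^+ 2 * (s^-1 * (s^-1 * vw + (x0 * w0 / s ^+ 3) * xv)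
            + (x0 * v0 / s ^+ 3) * (s^-1 * xw + (x0 * w0 / s ^+ 3) * xx))
  = v0 * w0 + vw.
Proof.
move=> s0 sx -> -> ->.
(* The error term is a multiple of [1 - x0 ^+ 2 - s ^+ 2], which vanishes by [sx]. *)
rewrite [LHS](_ : _ = v0 * w0 + vw + v0 * w0 * (1 - x0 ^+ 2 - s ^+ 2) / s ^+ 2).
  by rewrite -sx subrr mulr0 mul0r addr0.
by field.
Qed.

(** Away from the poles, the ambient derivatives of [height] and [angular] are computed from [acos];
    tangency expresses the products of tails through first coordinates, and [warped_identity]
    concludes. *)
Lemma warped_metric_tangent x v w : dotv x x = 1 ->
  dotv x v = 0 -> dotv x w = 0 -> warped_metric x v w = dotv v w.
Proof.
move=> xx xv xw; rewrite /warped_metric; case: ifPn => // s0.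
have xI := sphere_coord_itv xx.
set x0 := x ord0 ord0 in xI *.
have sE : sin (height x) = Num.sqrt (1 - x0 ^+ 2) by rewrite sin_acos.
(* [Num.sqrt] is 0 on nonpositive reals, so a nonzero sine puts [x0] strictly between -1 and 1,
   where [acos] is differentiable. *)
have x2 : 0 < 1 - x0 ^+ 2.
  by rewrite ltNge; apply: contra s0 => /ler0_sqrtr; rewrite sE => ->.
have xI' : -1 < x0 < 1.
  by move: x2; rewrite expr2; move: x0 {xI sE} => x0 x2; apply/andP; split; nra.
set s := sin (height x) in s0 *.
have s2 : s ^+ 2 = 1 - x0 ^+ 2 by rewrite /s sE sqr_sqrtr// ltW.
have dc u : 'D_u (fun z : 'rV[R]_p.+2 => z ord0 ord0) x = u ord0 ord0.
  by have [] := is_derive_coord ord0 x u.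
have cd : differentiable (fun z : 'rV[R]_p.+2 => z ord0 ord0) x.
  exact: differentiable_coord.
have dacos : is_derive x0 1 (@acos R) (- s^-1).
  by rewrite /s sE; exact: is_derive1_acos.
have dheight u : 'D_u height x = - s^-1 * u ord0 ord0.
  by have [_ ->] := is_derive_comp_coord u cd dacos; rewrite dc.
have dsin : is_derive x0 1 (fun t => sin (acos t)) (- x0 / s).
  have := is_derive1_comp (is_derive_sin (acos x0)) dacos.
  by rewrite acosK ?in_itv//= => D; apply: (is_derive_eq D); rewrite /GRing.scale /=; ring.
have dinv : is_derive x0 1 (fun t => (sin (acos t))^-1) (x0 / s ^+ 3).
  have [D1 D2] := dsin.
  split; first exact: derivableV.
  rewrite deriveV// D2 -/s /GRing.scale /= -/(height x) -/s; by field.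
have dang u : 'D_u angular x = s^-1 *: tail u + (x0 * u ord0 ord0 / s ^+ 3) *: tail x.
  have D : is_derive x u angular
      (s^-1 *: tail u + (x0 * u ord0 ord0 / s ^+ 3) *: tail x).
    apply/is_derive_mx => i j.
    have Dj := is_derive_coord (lift ord0 j) x u.
    have Di := is_derive_comp_coord u cd dinv.
    have := is_deriveM Di Dj.
    have -> : (fun z : 'rV[R]_p.+2 => (sin (acos (z ord0 ord0)))^-1) *
        (fun z : 'rV[R]_p.+2 => z ord0 (lift ord0 j))
       = (fun z : 'rV[R]_p.+2 => angular z i j).
      by apply/funext => z; rewrite /angular !mxE.
    move=> D; apply: (is_derive_eq D); rewrite dc !mxE /GRing.scale /= -/s; ring.
  by have [] := D.
rewrite /sphere_metric !dang !dheight.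
rewrite dotvDl !dotvZl ![dotv _ (_ + _)]dotvC !dotvDl !dotvZl.
move: xx xv xw; rewrite !dotv_recl -/x0 => xx xv xw.
rewrite (dotvC (tail w) (tail v)) (dotvC (tail w) (tail x)).
apply: warped_identity => //; rewrite ?s2 -?xx; lra.
Qed.

End WarpedMetric.

(** * The hemisphere *)

Section HemisphereProduct.
Context {R : realType} {p q : nat}.

Notation N := (p.+2 + q.+1)%N.
Implicit Types z w : 'rV[R]_N.

Lemma acos_le_pihalf (x : R) : -1 <= x <= 1 -> (acos x <= pi / 2) = (0 <= x).
Proof.
move=> xI; rewrite leNgt -ltr_cos ?in_itv/=; last 2 first.
- by rewrite divr_ge0 ?pi_ge0// ler_pdivrMr// ler_peMr ?pi_ge0// ler1n.
- by rewrite acos_ge0 ?acos_lepi.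
by rewrite cos_pihalf acosK ?in_itv// -leNgt.
Qed.

Lemma potentialE z : sphere_product p q z -> potential p q z = lsubmx z ord0 ord0.
Proof. by move=> [/sphere_coord_itv zI _]; rewrite /potential acosK. Qed.

Lemma hemisphere_productE z : hemisphere_product p q z <->
  sphere_product p q z /\ 0 <= lsubmx z ord0 ord0.
Proof.
split=> [[Xz hz]|[Xz hz]]; have [/sphere_coord_itv zI _] := Xz; split => //=.
  by rewrite -acos_le_pihalf.
by rewrite /height acos_le_pihalf.
Qed.

(* A point with vanishing first coordinate is left, in the direction of the
   opposite pole, along a great circle. *)
Lemma interior_hemisphere z :
  interior_in (sphere_product p q) (hemisphere_product p q) z ->
  0 < lsubmx z ord0 ord0.
Proof.
move=> [/hemisphere_productE[[Sz Sz'] z0] [V [oV Vz XVM]]].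
rewrite lt_neqAle z0 andbT; apply/negP => /eqP z00.
pose e : 'rV[R]_p.+2 := delta_mx ord0 ord0.
(* Fixed vectors with coefficients [cos t] and [sin t], so that continuity in [t] is immediate. *)
pose curve (t : R) : 'rV[R]_N :=
  (cos t *: row_mx (lsubmx z) 0 + row_mx 0 (rsubmx z)) + sin t *: row_mx (- e) 0.
have curveE t : curve t = row_mx (cos t *: lsubmx z - sin t *: e) (rsubmx z).
  rewrite /curve !scale_row_mx !add_row_mx scaler0 scaler0.
  by rewrite !addr0 add0r scalerN.
have cz : curve t @[t --> (0 : R)] --> curve 0.
  apply: cvgD; last by apply: cvgZr_tmp; exact: continuous_sin.
  by apply: cvgD; [apply: cvgZr_tmp; exact: continuous_cos|exact: cvg_cst].
have c0 : curve 0 = z.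
  by rewrite curveE cos0 sin0 scale1r scale0r subr0 hsubmxK.
have /cz/nbhs_ballP[d d0 dV] : nbhs (curve 0) V.
  by rewrite c0; exact: open_nbhs_nbhs.
(* The bound [d / 2] keeps the curve in [V]; the bound 1 keeps [t] below [pi], so that
   [sin t > 0]. *)
pose t := Num.min (d / 2) 1 : R.
have t0 : 0 < t by rewrite lt_min divr_gt0 //= ltr01.
have Vt : V (curve t).
  apply: dV; rewrite -ball_normE /= sub0r normrN gtr0_norm//.
  by rewrite gt_min ltr_pdivrMr// ltr_pMr// ltr1n.
(* Since its first coordinate vanishes, [lsubmx z] is orthogonal to [e], so the curve stays on the
   sphere. *)
have zeE : dotv (lsubmx z) e = 0.
  rewrite dotv_recl -z00 mul0r add0r /dotv big1// => i _.
  by rewrite !mxE andbF mulr0.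
have eeE : dotv e e = 1.
  rewrite dotv_recl !mxE !eqxx mulr1 /dotv big1 ?addr0// => i _.
  by rewrite !mxE andbF mulr0.
have Xt : sphere_product p q (curve t).
  rewrite curveE; split; rewrite /sphere /= ?row_mxKl ?row_mxKr//.
  rewrite dotvBl !dotvZl ![dotv _ (_ - _)]dotvC !dotvBl !dotvZl.
  rewrite (dotvC e (lsubmx z)) zeE eeE (Sz : dotv _ _ = 1).
  by have := cos2Dsin2 t; rewrite !expr2; lra.
have /hemisphere_productE[_] := XVM _ (conj Xt Vt).
rewrite curveE row_mxKl !mxE !eqxx mulr1.
have : 0 < sin t.
  apply: sin_gt0_pi; rewrite t0 /=; apply: (@le_lt_trans _ _ 1).
    by rewrite ge_min lexx orbT.
  by apply: lt_le_trans (pi_ge2 R); rewrite ltr1n.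
by have := z00; rewrite mxE => <-; rewrite mulr0; lra.
Qed.

Lemma hemisphere_interior z :
  sphere_product p q z -> 0 < lsubmx z ord0 ord0 ->
  interior_in (sphere_product p q) (hemisphere_product p q) z.
Proof.
move=> Xz z0; split; first by apply/hemisphere_productE; split => //; exact: ltW.
exists [set w | 0 < lsubmx w ord0 ord0]; split => //.
- apply: (@open_comp _ _ (fun w => lsubmx w ord0 ord0) [set t | 0 < t]).
    move=> w _; apply: (@differentiable_continuous R).
    under eq_fun do rewrite mxE; exact: differentiable_coord.
  exact: open_gt.
- by move=> w [Xw /= w0]; apply/hemisphere_productE; split => //; exact: ltW.
Qed.

(** * Smoothness of constants and coordinates *)

Lemma pder_cst n (W : normedModType R) (a : W) (i : 'I_n) :
  pder i (cst a : 'rV[R]_n -> W) = cst 0.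
Proof. by apply/funext => x; exact: derive_cst. Qed.

Lemma smooth_on_cst n (W : normedModType R) (U : set 'rV[R]_n) (a : W) :
  smooth_on U (cst a).
Proof.
move=> s x _; have [b ->] : exists b, foldr (fun i k => pder i k) (cst a) s = cst b.
  elim: s => [|i s [b IH]]; first by exists a.
  by exists 0; rewrite /= IH pder_cst.
exact: differentiable_cst.
Qed.

Lemma smooth_on_coord n (U : set 'rV[R]_n) (k : 'I_n) :
  smooth_on U (fun x => x ord0 k).
Proof.
have pc i : pder i (fun x : 'rV[R]_n => x ord0 k) = cst ((delta_mx ord0 i : 'rV[R]_n) ord0 k).
  apply/funext => x; have [_ D] := is_derive_coord k x (delta_mx ord0 i).
  exact: D.
(* [foldr] applies the last index of [s] first, so induction from the right turns the coordinate
   into a constant at once. *)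
elim/last_ind => [|s i _] x Ux; first exact: differentiable_coord.
by rewrite foldr_rcons pc; exact: (smooth_on_cst (U := U)).
Qed.

(** [fluid_equations] is applied to the two sphere components of [phi]; on their derivatives, which
    are tangent, the warped metric is the dot product. *)
Lemma fluid_equations_chart n (U : set 'rV[R]_n) phi :
  (1 < q)%N ->
  local_parametrization (sphere_product p q) U phi ->
  (n + (1 + 1) = p.+2 + q.+1)%N ->
  forall u, U u ->
  let g := metric_components (doubly_warped_metric p q) phi in
  let F := potential p q \o phi in
  F u *: traceless_ricci g u = traceless_hessian g F u /\
  laplacian g F u =
    ((n%:R - 2) / (2 * (n%:R - 1)) * scalar_curvature g u
     + n%:R / (n%:R - 1) * (- ((p.+2%:R - 1) * (n%:R - 1) / 2))) * F u.
Proof.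
move=> q_gt1 [oU sm imm _ chart] dimE u Uu g F.
have [V [_ VE]] := chart U oU (@subset_refl _ U).
have XU y : U y -> sphere_product p q (phi y).
  move=> Uy; have : (phi @` U) (phi y) by exists y.
  by rewrite VE => -[].
have JP := jet_lsubmx (smooth_jet oU sm).
have JQ := jet_rsubmx (smooth_jet oU sm).
have PP y : U y -> dotv (lsubmx (phi y)) (lsubmx (phi y)) = 1.
  by move=> /XU[].
have QQ y : U y -> dotv (rsubmx (phi y)) (rsubmx (phi y)) = 1.
  by move=> /XU[].
pose c : R := (q%:R - 1) / (p%:R + 1).
have q1 : 0 < q%:R - 1 :> R by rewrite subr_gt0 ltr1n.
have p1 : 0 < p%:R + 1 :> R by rewrite ltr_wpDl ?ler0n.
have c_gt0 : 0 < c by rewrite divr_gt0.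
have rfree y : U y -> row_free (row_mx (\matrix_i lsubmx (pder i phi y))
                                       (\matrix_i rsubmx (pder i phi y))).
  move=> Uy; rewrite (_ : row_mx _ _ = 'J phi y); first exact: imm.
  apply/row_matrixP => i; rewrite row_row_mx !rowK hsubmxK.
  by rewrite /pder deriveEjacobian ?rowE//; exact: (sm [::] y Uy).
have gE y : U y -> g y =
    (\matrix_i lsubmx (pder i phi y)) *m (\matrix_i lsubmx (pder i phi y))^T
    + c *: ((\matrix_i rsubmx (pder i phi y)) *m
            (\matrix_i rsubmx (pder i phi y))^T).
  move=> Uy; apply/matrixP => i j; rewrite mxE /doubly_warped_metric.
  rewrite warped_metric_tangent ?PP//.
  - by rewrite [RHS]mxE gramE [X in _ = _ + X]mxE gramE.
  - exact: (normal_tangent oU JP PP i Uy).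
  - exact: (normal_tangent oU JP PP j Uy).
apply: (fluid_equations oU c_gt0 dimE JP JQ PP QQ rfree gE) => //.
(* The Einstein ratio, as [p.+2 - 1 = p + 1] and [q.+1 - 2 = q - 1]. *)
- rewrite /c -!natr1; field; exact: lt0r_neq0.
- by move=> z Uz; rewrite /F /= potentialE//; exact: XU.
Qed.

End HemisphereProduct.

Theorem mainTheorem4 (R : realType) (p q : nat) (hq : (1 < q)%N) :
  exists rho : 'rV[R]_(p.+2 + q.+1) -> R,
    static_perfect_fluid (p + q + 1)%N
      (sphere_product p q) (hemisphere_product p q)
      (doubly_warped_metric p q) (potential p q) rho.
Proof.
pose n := (p + q + 1)%N.
exists (cst (- ((p.+2%:R - 1) * (n%:R - 1) / 2))); split.
(* On the product the potential is the first ambient coordinate, which is smooth on the whole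
   space. *)
- move=> z Xz; exists setT, (fun w => w ord0 (lshift q.+1 ord0)); split => //.
  + exact: openT.
  + exact: smooth_on_coord.
  + by move=> w _ Xw; rewrite potentialE// mxE.
- move=> z _; exists setT, (cst (- ((p.+2%:R - 1) * (n%:R - 1) / 2))).
  by split => //; [exact: openT|exact: smooth_on_cst].
- move=> z Iz; have [/hemisphere_productE[Xz _] _] := Iz.
  by rewrite potentialE//; exact: interior_hemisphere.
- move=> z Mz; have [Xz z0] := (hemisphere_productE z).1 Mz.
  rewrite potentialE//; split=> [z00|[_ nI]].
    by split => // /interior_hemisphere; rewrite z00 ltxx.
  apply/eqP; rewrite eq_le z0 andbT leNgt; apply/negP => z1.
  exact/nI/hemisphere_interior.
- move=> U phi chart u Uu Mu.
  apply: (fluid_equations_chart hq chart) => //; rewrite /n; lia.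
Qed.
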